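(* Let $\mathcal R$ be the tautological bundle over the Lagrangian Grassmannian $LG(n)$, and let $\phi(\mathcal R)$ be the characteristic class of $\mathcal R$ given by a symmetric polynomial $V$ in $n$ variables evaluated at the Chern roots of $\mathcal R$. Then $$\int_{LG(n)}\phi(\mathcal R)=\mathrm{Res}_{\mathbf z=\infty}\ \frac1{n!}\,\frac{V(z_1,\dots,z_n)\prod_{i\ne j}(z_j-z_i)\prod_{i<j}(z_i+z_j)}{\prod_{i=1}^n\prod_{j=1}^n(t_i-z_j)(t_i+z_j)},$$ where $\prod_{i\ne j}$ runs over ordered pairs of distinct indices in $\{1,\dots,n\}$ and $\prod_{i<j}$ over $1\le i<j\le n$.
   Context: $LG(n)$ is the Grassmannian of Lagrangian subspaces of the symplectic space $\mathbb C^{2n}$ with symplectic basis $q_1,\dots,q_n,p_1,\dots,p_n$, with the action of the torus $\mathbb T=(\mathbb C^* )^n$ of diagonal matrices; $t_1,\dots,t_n$ are the characters of the torus. The integral is the push-forward in $\mathbb T$-equivariant cohomology $H^*_{\mathbb T}(LG(n))\to H^*_{\mathbb T}(pt)$. Conventions: the fixed points are $p_I=\mathrm{Span}\{q_i,p_j: i\in I,\ j\notin I\}$ for $I\subseteq\{1,\dots,n\}$. At $p_I$ the class $\phi(\mathcal R)$ restricts to $V(t_i,-t_j: i\in I, j\notin I)$, and the weights of the torus action on the tangent space at $p_I$ are taken to be $\{\pm t_i\pm t_j:1\le i<j\le n\}\cup\{\pm2t_i:1\le i\le n\}$, where $t_i$ carries the sign $+$ if $i\in I$ and $-$ if $i\notin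 I$. With this convention the Berline–Vergne localization formula expresses the integral as the sum over $I$ of $V(t_i,-t_j: i\in I, j\notin I)$ divided by the product of these weights. Iterated residue at infinity: for a function $f(\mathbf z)$, $\mathbf z=(z_1,\dots,z_n)$, that is a quotient of a holomorphic function by a product of affine forms, $\mathrm{Res}_{\mathbf z=\infty}f=\mathrm{Res}_{z_1=\infty}\cdots\mathrm{Res}_{z_n=\infty}f\,d\mathbf z:=\left(\frac1{2\pi i}\right)^n\int_{|z_1|=R_1}\cdots\int_{|z_n|=R_n}f\,d\mathbf z$ with $1\ll R_1\ll\dots\ll R_n$, the circles being oriented so that in one variable the residue at infinity is minus the sum of the residues at all finite poles. The $t_i$ are treated as generic constants. *)

(* Defs.v *)
From HB Require Import structures.
From mathcomp Require Import all_boot all_order all_algebra.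
From mathcomp Require Import complex.
From mathcomp Require Import all_classical all_reals all_analysis.
(* Not imported: its notations clash with those of MathComp-Analysis. *)
From mathcomp Require mpoly.

Set Implicit Arguments.
Unset Strict Implicit.
Unset Printing Implicit Defensive.

Import Order.TTheory GRing.Theory Num.Theory.
Import numFieldNormedType.Exports.

Local Open Scope classical_set_scope.
Local Open Scope ring_scope.
Local Open Scope complex_scope.

Section LagrangianGrassmannian.
Variables (R : realType) (n : nat).

(* The symplectic space C^(2n): the first n coordinates are those along
   q_1, ..., q_n, the last n those along p_1, ..., p_n. *)
Definition symplectic_space := 'rV[R[i]]_(n + n).

Definition q_vec (i : 'I_n) : symplectic_space := delta_mx 0 (lshift n i).
Definition p_vec (i : 'I_n) : symplectic_space := delta_mx 0 (rshift n i).

Definition symplectic_form (u v : symplectic_space) : R[i] :=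
  \sum_(i < n) (u 0 (lshift n i) * v 0 (rshift n i)
                - u 0 (rshift n i) * v 0 (lshift n i)).

Definition LG : set {vspace symplectic_space} :=
  [set L | \dim L = n /\
           (forall u v, u \in L -> v \in L -> symplectic_form u v = 0)].

(* x in (C^* )^n acts by diag(x_1, .., x_n, x_1^-1, .., x_n^-1), so q_i has
   weight t_i and p_i has weight - t_i. *)
Definition torus_act (x : 'I_n -> R[i]) : 'End(symplectic_space) :=
  linfun (mulmxr (diag_mx (row_mx (\row_i x i) (\row_i (x i)^-1)))).

Definition torus_fixed : set {vspace symplectic_space} :=
  [set L | forall x : 'I_n -> R[i], (forall i, x i != 0) ->
           (torus_act x @: L)%VS = L].

(* A fixed point is L = p_I with I = {i | q_i \in L}.  The fibre of the
   tautological bundle at L is L itself, whose weights are t_i for i \in I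
   and - t_i for i \notin I; these are the Chern roots of the bundle,
   restricted to L. *)
Definition fixed_weight (t : 'I_n -> R[i]) (L : {vspace symplectic_space})
    (i : 'I_n) : R[i] :=
  if q_vec i \in L then t i else - t i.

(* The product of the weights at L of the tangent space, with the sign
   convention that these are the sums of two weights of the fibre L (and not
   of its dual). *)
Definition tangent_euler (t : 'I_n -> R[i]) (L : {vspace symplectic_space}) :
    R[i] :=
  (\prod_(i < n) \prod_(j < n | (i < j)%N)
      (fixed_weight t L i + fixed_weight t L j))
  * \prod_(i < n) (2 * fixed_weight t L i).

(* Restriction to the fixed point L of the equivariant characteristic class
   phi(R) given by V. *)
Definition char_class (V : mpoly.mpoly n R[i]) (t : 'I_n -> R[i])
    (L : {vspace symplectic_space}) : R[i] :=
  mpoly.meval (fixed_weight t L) V.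

(* The push-forward to a point of an equivariant class, given by its
   restrictions alpha to the fixed points, through the Berline-Vergne
   localization formula; t is the point of the Lie algebra of the torus at
   which elements of H^*_T(pt) = C[t_1, .., t_n] are evaluated. *)
Definition LG_integral (t : 'I_n -> R[i])
    (alpha : {vspace symplectic_space} -> R[i]) : R[i] :=
  \sum_(L \in LG `&` torus_fixed) (alpha L / tangent_euler t L).

End LagrangianGrassmannian.

Section ResidueAtInfinity.
Variable R : realType.

Definition complex_integral (a b : R) (f : R -> R[i]) : R[i] :=
  (Rintegral lebesgue_measure `[a, b] (fun x => complex.Re (f x)))
  +i* (Rintegral lebesgue_measure `[a, b] (fun x => complex.Im (f x))).

Definition circle_point (r theta : R) : R[i] :=
  r%:C * (cos theta +i* sin theta).

(* (2 pi i)^-1 times the integral of f over the circle |z| = r run clockwise: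
   the sign makes the residue at infinity minus the sum of the finite ones. *)
Definition clockwise_circle_integral (r : R) (f : R[i] -> R[i]) : R[i] :=
  - (2 * pi%:C * 'i)^-1 *
  complex_integral 0 (2 * pi)
    (fun theta => f (circle_point r theta) * ('i * circle_point r theta)).

(* The integral over |z_1| = r_1 is the outermost one. *)
Fixpoint torus_integral (n : nat) :
    n.-tuple R -> (n.-tuple R[i] -> R[i]) -> R[i] :=
  match n with
  | 0 => fun _ f => f [tuple]
  | m.+1 => fun r f =>
      clockwise_circle_integral (thead r)
        (fun z => torus_integral [tuple of behead r]
                    (fun w : m.-tuple R[i] => f [tuple of z :: w]))
  end.

(* P holds for 1 << r_1 << r_2 << ... << r_n: for r_1 large enough, then for
   r_2 large enough depending on r_1, and so on. *)
Fixpoint near_separated_radii (n : nat) : (n.-tuple R -> Prop) -> Prop :=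
  match n with
  | 0 => fun P => P [tuple]
  | m.+1 => fun P =>
      \forall r \near +oo,
        near_separated_radii (fun s : m.-tuple R => P [tuple of r :: s])
  end.

Definition is_residue_at_infinity (n : nat) (f : n.-tuple R[i] -> R[i])
    (l : R[i]) : Prop :=
  near_separated_radii (fun r : n.-tuple R => torus_integral r f = l).

End ResidueAtInfinity.

(* Main.v *)
Require Import Defs.
From mathcomp Require Import all_boot all_order all_fingroup all_algebra.
From mathcomp Require Import complex.
From mathcomp Require Import all_classical all_reals all_analysis.
From mathcomp Require mpoly.
From mathcomp Require Import ring.

(* The integrand is a polynomial divided by prod_k prod_j (t_j^2 - z_k^2), so
   the variables separate and the iterated residue can be taken one variable
   at a time: each clockwise integral of a polynomial over prod_j (t_j^2 - z^2)
   is minus the sum of the residues at the 2n simple poles +-t_j.  The result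
   is a sum over all assignments of a pole to each variable.  The numerator
   prod (z_j - z_i) prod (z_i + z_j) vanishes when two variables are assigned
   poles with the same index j up to sign, which leaves the signed
   permutations.  By symmetry the n! permutations contribute equally, and the
   remaining sum over signs is the Berline-Vergne sum over the Lagrangian
   subspaces fixed by the torus, the coordinate ones. *)

Set Implicit Arguments.
Unset Strict Implicit.
Unset Printing Implicit Defensive.

Import Order.TTheory GRing.Theory Num.Theory.
Import numFieldNormedType.Exports.
Local Open Scope classical_set_scope.
Local Open Scope ring_scope.
Local Open Scope complex_scope.

(** * Integrals of continuous complex-valued functions over a segment *)

Section ComplexIntegral.
Variable R : realType.
Implicit Types (f g : R -> R[i]) (a b r s x : R) (c : R[i]).

(** Componentwise, because [complex_integral] is defined by two real integrals and the integrability
    results used are real ones. *)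
Definition complex_continuous f : Prop :=
  continuous (@complex.Re R \o f) /\ continuous (@complex.Im R \o f).

Lemma complex_continuous_cst c : complex_continuous (fun=> c).
Proof. by split=> x; apply: cvg_cst. Qed.

Lemma complex_continuousD f g : complex_continuous f -> complex_continuous g ->
  complex_continuous (fun x => f x + g x).
Proof.
move=> [fR fI] [gR gI]; split=> x.
- have -> : @complex.Re R \o (fun x => f x + g x) =
            (@complex.Re R \o f) \+ (@complex.Re R \o g).
    by apply/funext => y /=; case: (f y); case: (g y).
  by apply: cvgD; [exact: fR|exact: gR].
- have -> : @complex.Im R \o (fun x => f x + g x) =
            (@complex.Im R \o f) \+ (@complex.Im R \o g).
    by apply/funext => y /=; case: (f y); case: (g y).
  by apply: cvgD; [exact: fI|exact: gI].
Qed.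

Lemma complex_continuousM f g : complex_continuous f -> complex_continuous g ->
  complex_continuous (fun x => f x * g x).
Proof.
move=> [fR fI] [gR gI]; split=> x.
- have -> : @complex.Re R \o (fun x => f x * g x) =
            (fun x => complex.Re (f x) * complex.Re (g x)
                      - complex.Im (f x) * complex.Im (g x)).
    by apply/funext => y /=; case: (f y); case: (g y).
  by apply: cvgB; apply: cvgM; [exact: fR|exact: gR|exact: fI|exact: gI].
- have -> : @complex.Im R \o (fun x => f x * g x) =
            (fun x => complex.Re (f x) * complex.Im (g x)
                      + complex.Im (f x) * complex.Re (g x)).
    by apply/funext => y /=; case: (f y); case: (g y).
  by apply: cvgD; apply: cvgM; [exact: fR|exact: gI|exact: fI|exact: gR].
Qed.

Lemma complex_continuousV f : complex_continuous f -> (forall x, f x != 0) ->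
  complex_continuous (fun x => (f x)^-1).
Proof.
move=> [fR fI] f0.
pose N x := complex.Re (f x) ^+ 2 + complex.Im (f x) ^+ 2.
have N0 x : N x != 0.
  rewrite /N; have := f0 x; case: (f x) => u v /= uv0.
  by rewrite paddr_eq0 ?sqr_ge0// !sqrf_eq0; move: uv0; rewrite eq_complex.
have cN : continuous N.
  move=> x; apply: cvgD; apply: cvgM;
    [exact: fR|exact: fR|exact: fI|exact: fI].
have cNV x : (fun y => (N y)^-1) @ x --> (N x)^-1.
  by apply: cvgV; [exact: N0|exact: cN].
split=> x.
- have -> : @complex.Re R \o (fun x => (f x)^-1) =
            (fun x => complex.Re (f x) * (N x)^-1).
    by apply/funext => y; rewrite /N /=; case: (f y).
  by apply: cvgM; [exact: fR|exact: cNV].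
- have -> : @complex.Im R \o (fun x => (f x)^-1) =
            (fun x => - (complex.Im (f x) * (N x)^-1)).
    by apply/funext => y; rewrite /N /=; case: (f y).
  by apply: cvgN; apply: cvgM; [exact: fI|exact: cNV].
Qed.

Let mu : {measure set (measurableTypeR R) -> \bar R} := @lebesgue_measure R.

Let complex_integralE a b f : complex_integral a b f =
  (\int[mu]_(x in `[a, b]) complex.Re (f x))
  +i* (\int[mu]_(x in `[a, b]) complex.Im (f x)).
Proof. by []. Qed.

Lemma continuous_itv_integrable (h : R -> R) a b : continuous h ->
  mu.-integrable `[a, b]%classic (EFin \o h).
Proof.
move=> ch; apply: continuous_compact_integrable; first exact: segment_compact.
exact: continuous_subspaceT.
Qed.

Lemma complex_integralD a b f g :
  complex_continuous f -> complex_continuous g ->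
  complex_integral a b (fun x => f x + g x)
  = complex_integral a b f + complex_integral a b g.
Proof.
move=> [fR fI] [gR gI]; rewrite !complex_integralE.
have DR := RintegralD (mu := mu) (measurable_itv _)
  (continuous_itv_integrable a b fR) (continuous_itv_integrable a b gR).
have DI := RintegralD (mu := mu) (measurable_itv _)
  (continuous_itv_integrable a b fI) (continuous_itv_integrable a b gI).
rewrite /= in DR DI.
apply/eqP; rewrite eq_complex /= -DR -DI.
by apply/andP; split; apply/eqP; apply: eq_Rintegral => x _;
  case: (f x); case: (g x).
Qed.

Lemma complex_integralZ a b c f : complex_continuous f ->
  complex_integral a b (fun x => c * f x) = c * complex_integral a b f.
Proof.
move=> [fR fI]; rewrite !complex_integralE.
have ifR := continuous_itv_integrable a b fR.
have ifI := continuous_itv_integrable a b fI.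
have cZ k (h : R -> R) : continuous h -> continuous (fun x => k * h x).
  by move=> ch x; apply: cvgM; [exact: cvg_cst|exact: ch].
case: c => u v.
have ZR k := RintegralZl (mu := mu) k (measurable_itv _) ifR.
have ZI k := RintegralZl (mu := mu) k (measurable_itv _) ifI.
have B := RintegralB (mu := mu) (measurable_itv _)
   (continuous_itv_integrable a b (cZ u _ fR))
   (continuous_itv_integrable a b (cZ v _ fI)).
have D := RintegralD (mu := mu) (measurable_itv _)
   (continuous_itv_integrable a b (cZ u _ fI))
   (continuous_itv_integrable a b (cZ v _ fR)).
rewrite /= in ZR ZI B D.
apply/eqP; rewrite eq_complex /=; apply/andP; split; apply/eqP.
- rewrite -!ZR -!ZI -B.
  by apply: eq_Rintegral => x _; case: (f x).
- rewrite -!ZR -!ZI -D.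
  by apply: eq_Rintegral => x _; case: (f x) => ? ? /=.
Qed.

Lemma complex_integral_cst a b c : a <= b ->
  complex_integral a b (fun=> c) = (b - a)%:C * c.
Proof.
move=> ab; rewrite !complex_integralE !Rintegral_cst//=.
rewrite lebesgue_measure_itv/= lte_fin.
case: c => u v; move: ab; rewrite le_eqVlt => /predU1P[->|ab].
  by rewrite ltxx subrr /= mul0r !mulr0.
rewrite ab /=; apply/eqP; rewrite eq_complex/= !mul0r subr0 addr0.
by rewrite ![(b - a) * _]mulrC !eqxx.
Qed.

Lemma normc_real x : `|x%:C| = `|x|%:C.
Proof. by rewrite normc_def /= expr0n addr0 sqrtr_sqr. Qed.

Lemma normci : `|'i : R[i]| = 1.
Proof. by rewrite normc_def /= expr0n expr1n add0r sqrtr1. Qed.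

(** The factor 2 comes from bounding real and imaginary parts separately. The loss is harmless: the
    bound is only applied to remainders that decay geometrically. *)
Lemma ler_norm_complex_integral a b f B : a <= b -> complex_continuous f ->
  (forall x, `|f x| <= B%:C) ->
  `|complex_integral a b f| <= (2 * (B * (b - a)))%:C.
Proof.
move=> ab [fR fI] fB.
have nRe (z : R[i]) : `|z| <= B%:C -> `|complex.Re z| <= B.
  by move=> zB; rewrite -lecR; exact: le_trans (normc_ge_Re _) zB.
have nIm (z : R[i]) : `|z| <= B%:C -> `|complex.Im z| <= B.
  move=> zB; rewrite -normrN -ReiNIm; apply: nRe.
  by rewrite normrM normci mulr1.
have H (h : R -> R) : continuous h -> (forall x, `|h x| <= B) ->
    `|\int[mu]_(x in `[a, b]) h x| <= B * (b - a).
  move=> ch hB; apply: le_trans (le_normr_Rintegral _ _) _ => //.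
    exact: continuous_itv_integrable.
  have -> : B * (b - a) = \int[mu]_(x in `[a, b]) B.
    rewrite Rintegral_cst//= lebesgue_measure_itv/= lte_fin.
    move: ab; rewrite le_eqVlt => /predU1P[->|ab].
      by rewrite ltxx subrr /=.
    by rewrite ab.
  apply: le_Rintegral => //.
  - apply: (@continuous_itv_integrable (fun x => `|h x|)) => x.
    by apply: cvg_norm; exact: ch.
  - apply: (@continuous_itv_integrable (fun x => B)) => x.
    exact: cvg_cst.
have IR : `|complex.Re (complex_integral a b f)| <= B * (b - a).
  by apply: H => // x; exact: nRe.
have II : `|complex.Im (complex_integral a b f)| <= B * (b - a).
  by apply: H => // x; exact: nIm.
rewrite [complex_integral a b f]complexE; apply: le_trans (ler_normD _ _) _.
by rewrite normrM normci mul1r !normc_real -rmorphD lecR mulr_natl mulr2n lerD.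
Qed.

End ComplexIntegral.

(** * Circle integrals: linearity, and the powers of the variable *)

Section CircleIntegral.
Variable R : realType.
Implicit Types (f g : R[i] -> R[i]) (r s x : R) (c w z : R[i]).

Local Notation cis x := (cos x +i* sin x).

Lemma cisD x s : cis (x + s) = cis x * cis s.
Proof. by rewrite cosD sinD [sin x * _ + _]addrC. Qed.

Lemma cis0 : cis 0 = 1 :> R[i].
Proof. by rewrite cos0 sin0. Qed.

Lemma cisX x n : cis x ^+ n = cis (x *+ n).
Proof.
by elim: n => [|n IHn]; rewrite ?mulr0n ?cis0// exprS mulrS cisD IHn.
Qed.

Lemma cis_neq0 x : cis x != 0.
Proof.
apply/eqP => c0; have := cisD x (- x).
by rewrite subrr cis0 c0 mul0r => /eqP; rewrite oner_eq0.
Qed.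

Lemma cisV x : (cis x)^-1 = cis (- x).
Proof.
by apply: (mulfI (cis_neq0 x)); rewrite -cisD subrr cis0 divff// cis_neq0.
Qed.

Lemma norm_cis x : `|cis x| = 1.
Proof. by rewrite normc_def /= cos2Dsin2 sqrtr1. Qed.

Lemma continuous_comp_scale s (h : R -> R) : continuous h ->
  continuous (fun x => h (s * x)).
Proof.
move=> ch x; apply: (@continuous_comp _ _ _ (fun y => s * y) h).
  by apply: cvgM; [exact: cvg_cst|exact: cvg_id].
exact: ch.
Qed.

Lemma complex_continuous_cis s : complex_continuous (fun x => cis (s * x)).
Proof.
split; apply: continuous_comp_scale.
- exact: continuous_cos.
- exact: continuous_sin.
Qed.

Lemma Rintegral_periodic (F F' : R -> R) a b : a < b ->
  (forall x, is_derive x 1 F (F' x)) -> continuous F' -> F a = F b ->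
  Rintegral lebesgue_measure `[a, b] F' = 0.
Proof.
move=> ab dF cF' Fab.
have dF1 x : derivable F x 1 by have [] := dF x.
have cF : continuous F.
  by move=> x; apply: differentiable_continuous; apply/derivable1_diffP.
rewrite /Rintegral (@continuous_FTC2 _ _ F)//.
- by rewrite Fab -EFinB subrr.
- exact: continuous_subspaceT.
- split=> [x _| |]; first exact: dF1.
  + by apply: cvg_at_right_filter; exact: cF.
  + by apply: cvg_at_left_filter; exact: cF.
- by move=> x _; rewrite derive1E; apply: derive_val.
Qed.

(** The components have primitives [s^-1 * sin (s * x)] and [- s^-1 * cos (s * x)], and the second
    hypothesis makes each take equal values at both ends. *)
Lemma complex_integral_cis s : s != 0 -> cis (s * (2 * pi)) = 1 ->
  complex_integral 0 (2 * pi) (fun x => cis (s * x)) = 0.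
Proof.
move=> s0 [c1 s1]; rewrite /complex_integral /=.
have tpi : 0 < 2 * pi :> R by rewrite mulr_gt0// pi_gt0.
have dS x : is_derive x 1 (fun y => s^-1 * sin (s * y)) (cos (s * x)).
  apply: is_derive_eq.
  by rewrite /GRing.scale /= mulr1 mulrCA mulVf// mulr1.
have dC x : is_derive x 1 (fun y => - s^-1 * cos (s * y)) (sin (s * x)).
  apply: is_derive_eq.
  by rewrite /GRing.scale /=; field.
rewrite (Rintegral_periodic tpi dS).
- rewrite (Rintegral_periodic tpi dC)//.
  + exact/continuous_comp_scale/continuous_sin.
  + by rewrite c1 mulr0 cos0.
- exact/continuous_comp_scale/continuous_cos.
- by rewrite s1 mulr0 sin0.
Qed.

Local Notation CI := (@clockwise_circle_integral R).

Lemma circle_point_neq0 r x : 0 < r -> circle_point r x != 0.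
Proof.
by move=> r0; rewrite mulf_neq0 ?cis_neq0// eq_complex /= eqxx andbT gt_eqF.
Qed.

Lemma norm_circle_point r x : 0 < r -> `|circle_point r x| = r%:C.
Proof. by move=> r0; rewrite normrM norm_cis mulr1 normc_real gtr0_norm. Qed.

Lemma complex_continuous_circle_point r : complex_continuous (circle_point r).
Proof.
apply: complex_continuousM; first exact: complex_continuous_cst.
by have := complex_continuous_cis 1; under eq_fun do rewrite mul1r.
Qed.

(** Continuity along the circle only, since the integrands have poles inside it. *)
Definition circle_continuous r f := complex_continuous (f \o circle_point r).

Lemma circle_continuous_horner r (p : {poly R[i]}) :
  circle_continuous r (horner p).
Proof.
rewrite /circle_continuous; elim/poly_ind: p => [|p c IHp].
  rewrite (_ : _ \o _ = fun=> 0); first exact: complex_continuous_cst.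
  by apply/funext => x /=; rewrite horner0.
rewrite (_ : _ \o _ = fun x => p.[circle_point r x] * circle_point r x + c).
  apply: complex_continuousD; last exact: complex_continuous_cst.
  by apply: complex_continuousM => //; exact: complex_continuous_circle_point.
by apply/funext => x /=; rewrite !hornerE.
Qed.

Lemma circle_continuous_subV r w : `|w| < r%:C ->
  circle_continuous r (fun z => (z - w)^-1).
Proof.
move=> wr; apply: complex_continuousV.
  apply: complex_continuousD; last exact: complex_continuous_cst.
  exact: complex_continuous_circle_point.
have r0 : 0 < r by rewrite -ltcR; exact: le_lt_trans (normr_ge0 w) wr.
move=> x; rewrite subr_eq0; apply/eqP => E.
by move: wr; rewrite -E norm_circle_point// ltxx.
Qed.

Lemma circle_continuousD r f g : circle_continuous r f ->
  circle_continuous r g -> circle_continuous r (fun z => f z + g z).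
Proof. exact: complex_continuousD. Qed.

Lemma circle_continuousM r f g : circle_continuous r f ->
  circle_continuous r g -> circle_continuous r (fun z => f z * g z).
Proof. exact: complex_continuousM. Qed.

Lemma circle_continuous_cst r c : circle_continuous r (fun=> c).
Proof. exact: complex_continuous_cst. Qed.

Lemma circle_continuous_sum (I : Type) (s : seq I) r (F : I -> R[i] -> R[i]) :
  (forall i, circle_continuous r (F i)) ->
  circle_continuous r (fun z => \sum_(i <- s) F i z).
Proof.
move=> cF; elim: s => [|i s IHs].
  by under eq_fun do rewrite big_nil; exact: circle_continuous_cst.
by under eq_fun do rewrite big_cons; exact: circle_continuousD.
Qed.

Let complex_continuous_integrand r f : circle_continuous r f ->
  complex_continuous (fun x => f (circle_point r x) * ('i * circle_point r x)).
Proof.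
move=> cf; apply: complex_continuousM => //.
apply: complex_continuousM; first exact: complex_continuous_cst.
exact: complex_continuous_circle_point.
Qed.

Lemma eq_circle_integral r f g :
  (forall x, f (circle_point r x) = g (circle_point r x)) -> CI r f = CI r g.
Proof.
move=> fg; congr (_ * complex_integral _ _ _).
by apply/funext => x; rewrite fg.
Qed.

Lemma circle_integralD r f g : circle_continuous r f ->
  circle_continuous r g -> CI r (fun z => f z + g z) = CI r f + CI r g.
Proof.
move=> cf cg; rewrite /clockwise_circle_integral -mulrDr.
rewrite -(complex_integralD _ _ (complex_continuous_integrand cf)
  (complex_continuous_integrand cg)).
by congr (_ * complex_integral _ _ _); apply/funext => x; rewrite mulrDl.
Qed.

Lemma circle_integralZ r c f : circle_continuous r f ->
  CI r (fun z => c * f z) = c * CI r f.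
Proof.
move=> cf; rewrite /clockwise_circle_integral mulrCA.
rewrite -(complex_integralZ _ _ _ (complex_continuous_integrand cf)).
by congr (_ * complex_integral _ _ _); apply/funext => x; rewrite mulrA.
Qed.

Lemma circle_integral0 r : CI r (fun=> 0) = 0.
Proof.
rewrite -[RHS](mul0r (CI r (fun=> 0))) -circle_integralZ.
  by congr clockwise_circle_integral; apply/funext => z; rewrite mul0r.
exact: circle_continuous_cst.
Qed.

Lemma circle_integral_sum (I : Type) (s : seq I) r (F : I -> R[i] -> R[i]) :
  (forall i, circle_continuous r (F i)) ->
  CI r (fun z => \sum_(i <- s) F i z) = \sum_(i <- s) CI r (F i).
Proof.
move=> cF; elim: s => [|i s IHs].
  by under eq_fun do rewrite big_nil; rewrite circle_integral0 big_nil.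
under eq_fun do rewrite big_cons.
by rewrite circle_integralD ?IHs ?big_cons//; exact: circle_continuous_sum.
Qed.

Let two_pi_gt0 : 0 < 2 * pi :> R.
Proof. by rewrite mulr_gt0// pi_gt0. Qed.

(** The boolean is the sign of the frequency, so that positive and negative powers of the variable
    are treated at once. *)
Let complex_integral_cisX (b : bool) k :
  complex_integral 0 (2 * pi) (fun x => cis ((-1) ^+ b * k.+1%:R * x)) = 0.
Proof.
apply: complex_integral_cis; first by rewrite mulf_neq0 ?signr_eq0 ?pnatr_eq0.
rewrite -mulrA [2 * pi]mulr_natl mulr_natl.
have E : cis (pi *+ 2 *+ k.+1) = 1 :> R[i].
  by rewrite -cisX cos2pi sin2pi expr1n.
case: b; last by rewrite expr0 mul1r.
by rewrite expr1 mulN1r -cisV E invr1.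
Qed.

Lemma circle_integralX r k : CI r (fun z => z ^+ k) = 0.
Proof.
rewrite /clockwise_circle_integral.
rewrite (_ : (fun _ => _) =
  fun x => 'i * r%:C ^+ k.+1 * cis ((-1) ^+ false * k.+1%:R * x)).
  rewrite complex_integralZ; last exact: complex_continuous_cis.
  by rewrite complex_integral_cisX !mulr0.
apply/funext => x; rewrite expr0 mul1r mulr_natl -cisX mulrCA -exprSr.
by rewrite exprMn mulrA.
Qed.

Lemma circle_integralXV r k : 0 < r ->
  CI r (fun z => (z ^+ k.+1)^-1) = if k == 0 then -1 else 0.
Proof.
move=> r0.
have z0 x := circle_point_neq0 x r0.
have i0 : 'i != 0 :> R[i] by rewrite eq_complex /= oner_eq0 andbF.
(* The factor ['i * z] from dz cancels one of the [k.+1] inverse powers; the integrand is constant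
   exactly when [k = 0]. *)
have E x : (circle_point r x ^+ k.+1)^-1 * ('i * circle_point r x) =
     'i * (r%:C^-1) ^+ k * cis (- (x *+ k)).
  rewrite exprSr invfM mulrCA -[_ * _ * circle_point r x]mulrA mulVf// mulr1.
  rewrite -cisV -cisX -exprVn.
  by rewrite -exprVn -mulrA -exprMn invfM.
rewrite /clockwise_circle_integral.
under eq_fun do rewrite E.
case: k {E} => [|k] /=.
  under eq_fun do rewrite mulr0n oppr0 cis0.
  rewrite complex_integral_cst ?ltW// expr0 !mulr1 subr0 rmorphM /=.
  rewrite (_ : 2%:C = 2); last by rewrite rmorph_nat.
  rewrite mulNr mulVf// !mulf_neq0 ?pnatr_eq0//.
  by rewrite eq_complex /= eqxx andbT gt_eqF ?pi_gt0.
under eq_fun do rewrite -mulr_natl -mulNr -mulN1r.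
rewrite complex_integralZ; last exact: complex_continuous_cis.
by rewrite (complex_integral_cisX true) !mulr0.
Qed.

End CircleIntegral.

(** * Residues of a simple pole and of a polynomial *)

Section Residues.
Variable R : realType.
Implicit Types (r x : R) (w z : R[i]) (p : {poly R[i]}).
Local Notation CI := (@clockwise_circle_integral R).

Lemma ler_norm_circle_integral r (f : R[i] -> R[i]) (B : R) : 0 < r ->
  circle_continuous r f -> (forall x, `|f (circle_point r x)| <= B%:C) ->
  `|CI r f| <= (2 * (B * r))%:C.
Proof.
move=> r0 cf fB.
have tpi : 0 < 2 * pi :> R by rewrite mulr_gt0// pi_gt0.
have cg : complex_continuous
    (fun x => f (circle_point r x) * ('i * circle_point r x)).
  apply: complex_continuousM => //.
  apply: complex_continuousM; first exact: complex_continuous_cst.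
  exact: complex_continuous_circle_point.
have gB x : `|f (circle_point r x) * ('i * circle_point r x)| <= (B * r)%:C.
  rewrite normrM normrM normci mul1r norm_circle_point// rmorphM /=.
  by rewrite ler_wpM2r// lecR ltW.
have := ler_norm_complex_integral (ltW tpi) cg gB.
rewrite /clockwise_circle_integral normrM normrN normfV !normrM normci mulr1.
rewrite normc_real (gtr0_norm (pi_gt0 R)) normr_nat subr0 => H.
rewrite mulrC ler_pdivrMr.
  apply: le_trans H _.
  rewrite (_ : 2 * pi%:C = (2 * pi)%:C); last by rewrite rmorphM /= rmorph_nat.
  by rewrite -rmorphM lecR mulrA.
by rewrite mulr_gt0// ltcR pi_gt0.
Qed.

(** The norm of [a] is a real number [e]; if [e] were positive, [C * q ^+ k] would drop below it for
    large [k]. *)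
Lemma eq0_of_le_geometric (a : R[i]) (C q : R) : 0 <= q < 1 ->
  (forall k, `|a| <= (C * q ^+ k)%:C) -> a = 0.
Proof.
move=> /andP[q0 q1] H; apply/eqP/contraT => a0.
have [e ae] : exists e, `|a| = e%:C.
  by exists (complex.Re `|a|); rewrite normc_def.
have e0 : 0 < e by rewrite -ltcR -ae normr_gt0.
have /cvgr_lt/(_ _ e0) : (fun k => C * q ^+ k) @ \oo --> (0 : R).
  by apply: cvg_geometric; rewrite ger0_norm.
move=> [N _ /(_ N (leqnn N)) /=].
by have := H N; rewrite ae lecR leNgt => /negbTE ->.
Qed.

(* Expanding 1/(z - w) = sum_(k < K) w^k/z^(k+1) + w^K/(z^K (z - w)), only the
   term k = 0 contributes, and the remainder is O((|w|/r)^K) for every K. *)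
Lemma circle_integral_subV r w : `|w| < r%:C ->
  CI r (fun z => (z - w)^-1) = -1.
Proof.
move=> wr.
have r0 : 0 < r by rewrite -ltcR; exact: le_lt_trans (normr_ge0 w) wr.
have [e we] : exists e, `|w| = e%:C.
  by exists (complex.Re `|w|); rewrite normc_def.
have e0 : 0 <= e by rewrite -lecR -we; exact: normr_ge0.
have er : e < r by rewrite -ltcR -we.
have z0 x := circle_point_neq0 x r0.
have zw x : circle_point r x - w != 0.
  apply/eqP => /subr0_eq E.
  by move: wr; rewrite -E norm_circle_point// ltxx.
have cV : circle_continuous r (fun z => z^-1).
  by have := @circle_continuous_subV _ r 0; under eq_fun do rewrite subr0;
    apply; rewrite normr0 ltcR.
have cXV k : circle_continuous r (fun z => (z ^+ k)^-1).
  elim: k => [|k IHk]; first by under eq_fun do rewrite expr0 invr1;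
    exact: circle_continuous_cst.
  by under eq_fun do rewrite exprS invfM; exact: circle_continuousM.
have cw := circle_continuous_subV wr.
(* [F k] is the remainder after [k] terms of the expansion. From 1/(z - w) = 1/z + w/(z (z - w)) it
   equals w^k/z^(k+1) plus [F k.+1]. *)
pose F k z := w ^+ k * ((z ^+ k)^-1 * (z - w)^-1).
have cF k : circle_continuous r (F k).
  by apply: circle_continuousM;
    [exact: circle_continuous_cst|exact: circle_continuousM].
have step k : CI r (F k) = w ^+ k * (if k == 0 then -1 else 0) + CI r (F k.+1).
  rewrite -(circle_integralXV k r0) -circle_integralZ// -circle_integralD//;
    last by apply: circle_continuousM => //; exact: circle_continuous_cst.
  apply: eq_circle_integral => x; rewrite /F.
  move: (circle_point r x) (z0 x) (zw x) => z z1 zw1.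
  rewrite !exprS !invfM; have zk : z ^+ k != 0 by rewrite expf_neq0.
  move: (z ^+ k) zk (w ^+ k) => Z zk Wk. by field; apply/and3P.
have main k : CI r (F 0) = -1 + CI r (F k.+1).
  elim: k => [|k ->]; first by rewrite step eqxx expr0 mul1r.
  by rewrite (step k.+1) /= mulr0 add0r.
have -> : CI r (fun z => (z - w)^-1) = CI r (F 0).
  by apply: eq_circle_integral => x; rewrite /F !expr0 invr1 !mul1r.
apply/eqP; rewrite -subr_eq0 opprK; apply/eqP.
apply: (@eq0_of_le_geometric _ (2 * ((r - e)^-1 * r) * (e / r)) (e / r)).
  by rewrite divr_ge0 ?(ltW r0)//= ltr_pdivrMr// mul1r.
move=> k; rewrite (main k) addrAC addNr add0r.
(* Puts the geometric bound in the form [2 * (B * r)] of the norm estimate, where [B] bounds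
   [F k.+1] on the circle because |z - w| is at least [r - e] there. *)
have -> : 2 * ((r - e)^-1 * r) * (e / r) * (e / r) ^+ k =
   2 * ((e ^+ k.+1 * ((r ^+ k.+1)^-1 * (r - e)^-1)) * r).
  rewrite -[_ * (e / r) * _]mulrA -exprS expr_div_n; ring.
apply: ler_norm_circle_integral => // x; rewrite /F.
rewrite !normrM !normfV !normrX norm_circle_point// we.
rewrite !rmorphM /= !fmorphV /= !rmorphXn /=.
apply: ler_wpM2l; first by rewrite exprn_ge0// lecR.
apply: ler_wpM2l; first by rewrite invr_ge0 exprn_ge0// lecR ltW.
rewrite lef_pV2 ?posrE ?normr_gt0//; last by rewrite ltcR subr_gt0.
rewrite rmorphB /= -we -(norm_circle_point x r0).
exact: lerB_dist.
Qed.

Lemma circle_integral_horner r p : CI r (horner p) = 0.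
Proof.
transitivity (CI r (fun z => \sum_(i < size p) p`_i * (z^+ i))).
  by apply: eq_circle_integral => x; rewrite horner_coef.
have cX i : circle_continuous r (fun z => z ^+ i).
  by have := circle_continuous_horner r 'X^i; congr circle_continuous;
    apply/funext => z; rewrite hornerXn.
rewrite circle_integral_sum => [|i]; last first.
  by apply: circle_continuousM => //; exact: circle_continuous_cst.
by rewrite big1// => i _; rewrite circle_integralZ// circle_integralX mulr0.
Qed.

End Residues.

(** * Partial fractions and the residue theorem for simple poles *)

Section PartialFractions.
Variables (F : fieldType) (I : finType) (W : I -> F).
Hypothesis W_inj : injective W.

(** The derivative at [W i] of the product of all ['X - (W j)%:P]. *)
Let den i := \prod_(j | j != i) (W i - W j).

Let den_neq0 i : den i != 0.
Proof.
rewrite prodf_seq_neq0; apply/allP => j _; apply/implyP => ji.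
by rewrite subr_eq0 eq_sym; apply: contra ji => /eqP/W_inj->.
Qed.

(** The difference of the two sides has size at most [#|I|] and vanishes at the [#|I|] distinct
    points [W i]. *)
Lemma lagrange_interpolation (p : {poly F}) : (size p <= #|I|)%N ->
  p = \sum_i (p.[W i] / den i) *: \prod_(j | j != i) ('X - (W j)%:P).
Proof.
move=> sp; set q := RHS.
have sq : (size q <= #|I|)%N.
  apply: leq_trans (size_sum _ _ _) _; apply/bigmax_leqP => i _.
  apply: leq_trans (size_scale_leq _ _) _.
  rewrite -(big_enum _ _ (predC1 i)) size_prod_XsubC -cardE cardC1 prednK//.
  by apply/card_gt0P; exists i.
apply/eqP; rewrite -subr_eq0; apply/eqP.
apply: (roots_geq_poly_eq0 (rs := [seq W i | i : I])).
- apply/allP => _ /mapP[i _ ->]; rewrite rootE hornerD hornerN.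
  rewrite /q horner_sum (bigD1 i)//=.
  rewrite [X in _ - (_ + X)]big1 => [|j ji]; last first.
    rewrite hornerZ horner_prod (bigD1 i)/=; last by rewrite eq_sym.
    by rewrite hornerXsubC subrr mul0r mulr0.
  rewrite addr0 hornerZ horner_prod.
  under eq_bigr do rewrite hornerXsubC.
  by rewrite divfK// subrr.
- by rewrite map_inj_uniq// enum_uniq.
- rewrite size_map -cardE; apply: leq_trans (size_polyD _ _) _.
  by rewrite geq_max size_polyN sp.
Qed.

(** Euclidean division by the product [D] of the linear factors: [q] is the quotient, and the
    remainder, which agrees with [p] at the roots of [D], is interpolated there. *)
Lemma partial_fractions (p : {poly F}) : exists q : {poly F}, forall z,
  (forall i, z != W i) ->
  p.[z] / \prod_i (z - W i) = q.[z] + \sum_i p.[W i] / den i * (z - W i)^-1.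
Proof.
pose D := \prod_i ('X - (W i)%:P).
have mD : D \is monic by exact: monic_prod_XsubC.
have DW z : D.[z] = \prod_i (z - W i).
  by rewrite horner_prod; apply: eq_bigr => i _; rewrite hornerXsubC.
have DW0 i : D.[W i] = 0 by rewrite DW (bigD1 i)//= subrr mul0r.
exists (p %/ D) => z zW.
have D0 : \prod_i (z - W i) != 0.
  by rewrite prodf_seq_neq0; apply/allP => i _; rewrite subr_eq0 zW.
have pm i : (p %% D).[W i] = p.[W i].
  by rewrite {2}(divp_eq p D) hornerD hornerM DW0 mulr0 add0r.
rewrite {1}(divp_eq p D) hornerD hornerM DW mulrDl mulfK//; congr (_ + _).
rewrite (@lagrange_interpolation (p %% D)); last first.
  rewrite -ltnS; apply: leq_trans (ltn_modpN0 _ (monic_neq0 mD)) _.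
  by rewrite size_prod_XsubC cardT enumT [index_enum I]unlock.
rewrite horner_sum mulr_suml; apply: eq_bigr => i _.
rewrite pm hornerZ horner_prod -mulrA; congr (_ * _).
under eq_bigr do rewrite hornerXsubC.
rewrite [in X in _ / X](bigD1 i)//= invfM mulrCA mulfV ?mulr1//.
by move: D0; rewrite (bigD1 i)//= mulf_eq0 negb_or => /andP[].
Qed.

End PartialFractions.

(** In the partial fraction decomposition the polynomial part integrates to 0 and each
    [(z - W i)^-1] to -1, all poles being inside the circle. *)
Lemma circle_integral_rational (R : realType) (I : finType) (W : I -> R[i])
    (r : R) (p : {poly R[i]}) :
  injective W -> 0 < r -> (forall i, `|W i| < r%:C) ->
  clockwise_circle_integral r (fun z => p.[z] / \prod_i (z - W i))
  = - \sum_i p.[W i] / \prod_(j | j != i) (W i - W j).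
Proof.
move=> W_inj r0 Wr; have [q qP] := partial_fractions W_inj p.
have cT i : circle_continuous r (fun z =>
    p.[W i] / \prod_(j | j != i) (W i - W j) * (z - W i)^-1).
  apply: circle_continuousM; first exact: circle_continuous_cst.
  exact: circle_continuous_subV.
transitivity (clockwise_circle_integral r (fun z => q.[z] +
    \sum_i p.[W i] / \prod_(j | j != i) (W i - W j) * (z - W i)^-1)).
  apply: eq_circle_integral => x; apply: qP => i; apply/eqP => E.
  by have := Wr i; rewrite -E norm_circle_point// ltxx.
rewrite circle_integralD; [|exact: circle_continuous_horner|
  exact: circle_continuous_sum].
rewrite circle_integral_horner add0r circle_integral_sum// -sumrN.
apply: eq_bigr => i _.
rewrite circle_integralZ; last exact: circle_continuous_subV.
by rewrite circle_integral_subV// mulrN1.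
Qed.

(** * Functions polynomial in each variable *)

Section SeparatelyPolynomial.
Variable K : comNzRingType.

(* Polynomiality in each variable separately is all that integrating one
   variable at a time requires, and it is stable under substituting constants
   for some of the variables. *)
Fixpoint separately_polynomial n : (n.-tuple K -> K) -> Prop :=
  match n with
  | 0 => fun=> True
  | m.+1 => fun f =>
      (forall w : m.-tuple K, exists p : {poly K},
         forall z, f [tuple of z :: w] = p.[z])
      /\ forall z, separately_polynomial (fun w => f [tuple of z :: w])
  end.

Lemma separately_polynomial_cst n c :
  separately_polynomial (fun _ : n.-tuple K => c).
Proof.
elim: n => //= n IHn; split=> // w.
by exists c%:P => z; rewrite hornerC.
Qed.

Lemma separately_polynomialD n (f g : n.-tuple K -> K) :
  separately_polynomial f -> separately_polynomial g ->
  separately_polynomial (fun z => f z + g z).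
Proof.
elim: n f g => //= n IHn f g [f1 f2] [g1 g2]; split=> [w|z]; last exact: IHn.
have [[p pE] [q qE]] := (f1 w, g1 w).
by exists (p + q) => z; rewrite hornerD pE qE.
Qed.

Lemma separately_polynomialM n (f g : n.-tuple K -> K) :
  separately_polynomial f -> separately_polynomial g ->
  separately_polynomial (fun z => f z * g z).
Proof.
elim: n f g => //= n IHn f g [f1 f2] [g1 g2]; split=> [w|z]; last exact: IHn.
have [[p pE] [q qE]] := (f1 w, g1 w).
by exists (p * q) => z; rewrite hornerM pE qE.
Qed.

Lemma separately_polynomial_sum n (I : Type) (s : seq I) (P : pred I)
    (f : I -> n.-tuple K -> K) : (forall i, separately_polynomial (f i)) ->
  separately_polynomial (fun z => \sum_(i <- s | P i) f i z).
Proof.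
move=> pf; elim: s => [|i s IHs].
  by under eq_fun do rewrite big_nil; exact: separately_polynomial_cst.
under eq_fun do rewrite big_cons; case: (P i) => //.
exact: separately_polynomialD.
Qed.

Lemma separately_polynomial_prod n (I : Type) (s : seq I) (P : pred I)
    (f : I -> n.-tuple K -> K) : (forall i, separately_polynomial (f i)) ->
  separately_polynomial (fun z => \prod_(i <- s | P i) f i z).
Proof.
move=> pf; elim: s => [|i s IHs].
  by under eq_fun do rewrite big_nil; exact: separately_polynomial_cst.
under eq_fun do rewrite big_cons; case: (P i) => //.
exact: separately_polynomialM.
Qed.

Lemma separately_polynomialX n (f : n.-tuple K -> K) k :
  separately_polynomial f -> separately_polynomial (fun z => f z ^+ k).
Proof.
move=> pf; elim: k => [|k IHk]; first exact: separately_polynomial_cst.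
by under eq_fun do rewrite exprS; exact: separately_polynomialM.
Qed.

Lemma separately_polynomial_tnth n (i : 'I_n) :
  separately_polynomial (fun z : n.-tuple K => tnth z i).
Proof.
elim: n i => [[]//|n IHn] i; case: (unliftP ord0 i) => [j|] ->.
- split=> [w|z]; first by exists (tnth w j)%:P => z; rewrite hornerC tnthS.
  by under eq_fun do rewrite tnthS; exact: IHn.
- split=> [w|z] /=; last exact: separately_polynomial_cst.
  by exists 'X => z; rewrite hornerX.
Qed.

Lemma separately_polynomial_meval n (V : mpoly.mpoly n K) :
  separately_polynomial (fun z => mpoly.meval (tnth z) V).
Proof.
under eq_fun do rewrite mpoly.mevalE.
apply: separately_polynomial_sum => m.
apply: separately_polynomialM; first exact: separately_polynomial_cst.
apply: separately_polynomial_prod => i.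
exact/separately_polynomialX/separately_polynomial_tnth.
Qed.

End SeparatelyPolynomial.

(** * Iterated residues when the poles are the same in every variable *)

Lemma big_tuple_cons (K : nmodType) (I : finType) n (G : n.+1.-tuple I -> K) :
  \sum_s G s = \sum_i \sum_(s : n.-tuple I) G [tuple of i :: s].
Proof.
rewrite pair_big /=.
rewrite (reindex (fun p : I * n.-tuple I => [tuple of p.1 :: p.2]))//=.
exists (fun s => (thead s, [tuple of behead s])) => [[i s] _|s _] /=.
  by congr pair; apply/val_inj.
by rewrite -tuple_eta.
Qed.

Section TorusIntegral.
Variables (R : realType) (I : finType) (W : I -> R[i]).
Hypothesis W_inj : injective W.

(** Induction on the number of variables: for a fixed value [z] of the outermost one, the inner
    integrals are given by the induction hypothesis, and what remains is again a polynomial in [z]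
    over the product of the [z - W i]. The poles are constants, so each radius only has to exceed
    their norms, whatever the order of the radii. *)
Lemma torus_integral_rational m (r : m.-tuple R) (F : m.-tuple R[i] -> R[i]) :
  separately_polynomial F ->
  (forall k, 0 < tnth r k) -> (forall k i, `|W i| < (tnth r k)%:C) ->
  torus_integral r
    (fun z => F z / \prod_(k < m) \prod_i (tnth z k - W i))
  = \sum_(s : m.-tuple I) F (map_tuple W s)
      * \prod_(k < m) - (\prod_(j | j != tnth s k) (W (tnth s k) - W j))^-1.
Proof.
elim: m r F => [|m IHm] r F /=.
  move=> _ _ _; rewrite big_ord0 invr1 mulr1 (bigD1 [tuple])//= big_ord0 mulr1.
  rewrite big1 ?addr0; last by move=> s; rewrite [s]tuple0 => /eqP.
  by congr F; apply/val_inj.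
move=> [pF1 pF2] r0 rW.
have rb k : tnth [tuple of behead r] k = tnth r (lift ord0 k).
  by rewrite [in RHS](tuple_eta r) tnthS.
have cW z (w : m.-tuple R[i]) :
    F [tuple of z :: w]
      / \prod_(k < m.+1) \prod_i (tnth [tuple of z :: w] k - W i)
    = (F [tuple of z :: w] * (\prod_i (z - W i))^-1)
      / \prod_(k < m) \prod_i (tnth w k - W i).
  rewrite big_ord_recl invfM mulrA tnth0; congr (_ / _).
  by apply: eq_bigr => k _; rewrite tnthS.
pose c i := - (\prod_(j | j != i) (W i - W j))^-1.
(* After the inner integrations the numerator is a linear combination of functions of [z] obtained
   by fixing the inner variables at poles; each is polynomial by the first half of separate
   polynomiality. *)
have [p pE] : exists p : {poly R[i]}, forall z,
    \sum_(s : m.-tuple I) F [tuple of z :: map_tuple W s]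
      * \prod_(k < m) c (tnth s k) = p.[z].
  pose q s := projT1 (cid (pF1 (map_tuple W s))).
  have qE s z : F [tuple of z :: map_tuple W s] = (q s).[z].
    by rewrite /q; case: cid.
  exists (\sum_(s : m.-tuple I) q s * (\prod_(k < m) c (tnth s k))%:P) => z.
  by rewrite horner_sum; apply: eq_bigr => s _; rewrite hornerM hornerC qE.
transitivity (clockwise_circle_integral (thead r)
    (fun z => p.[z] / \prod_i (z - W i))).
  congr clockwise_circle_integral; apply/funext => z.
  transitivity (torus_integral [tuple of behead r] (fun w : m.-tuple R[i] =>
      (F [tuple of z :: w] * (\prod_i (z - W i))^-1)
      / \prod_(k < m) \prod_i (tnth w k - W i))).
    by congr torus_integral; apply/funext => w; exact: cW.
  rewrite IHm.
  - rewrite -pE mulr_suml; apply: eq_bigr => s _.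
    by rewrite mulrAC.
  - apply: separately_polynomialM; first exact: pF2.
    exact: separately_polynomial_cst.
  - by move=> k; rewrite rb.
  - by move=> k i; rewrite rb.
rewrite circle_integral_rational//; [|exact: r0|exact: rW].
rewrite -sumrN big_tuple_cons; apply: eq_bigr => i _.
rewrite -mulrN -pE mulr_suml; apply: eq_bigr => s _.
rewrite big_ord_recl tnth0 mulrAC -mulrA; congr (F _ * (_ * _)).
  exact/val_inj.
by apply: eq_bigr => k _; rewrite tnthS.
Qed.

End TorusIntegral.

(** At each stage the radii above [M] already form a neighbourhood of infinity, so a bound
    independent of the other radii suffices. *)
Lemma near_separated_radii_gt (R : realType) n (M : R)
    (P : n.-tuple R -> Prop) :
  (forall r, (forall k, M < tnth r k) -> P r) -> near_separated_radii P.
Proof.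
elim: n P => [|n IHn] P PM /=; first by apply: PM => -[].
near=> r; apply: IHn => s sM; apply: PM => k.
case: (unliftP ord0 k) => [j|] ->; first by rewrite tnthS.
by rewrite tnth0; near: r; apply: nbhs_pinfty_gt; exact: num_real.
Unshelve. all: by end_near. Qed.

(** * Permutations of the variables and products over pairs *)

Section MevalMsym.
Import -(notations) mpoly.

(** Turns the formal symmetry of a polynomial into invariance of its values. *)
Lemma meval_msym n (K : comNzRingType) (s : 'S_n) (v : 'I_n -> K)
    (V : mpoly n K) :
  meval v (msym s V) = meval (v \o s) V.
Proof.
rewrite /msym /mmap raddf_sum mevalE /=.
apply: eq_bigr => m _; rewrite mevalM mevalC; congr (_ * _).
rewrite /mmap1 rmorph_prod /=; apply: eq_bigr => i _.
by rewrite rmorphXn /= mevalXU.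
Qed.

End MevalMsym.

Section PairProducts.
Variable K : comNzRingType.

Lemma prod_neqE n (g : 'I_n -> 'I_n -> K) :
  \prod_i \prod_(j | j != i) g i j
  = (\prod_(i < n) \prod_(j < n | (i < j)%N) g i j)
    * \prod_(i < n) \prod_(j < n | (i < j)%N) g j i.
Proof.
rewrite [X in _ * X](exchange_big_dep predT)//= -big_split /=.
apply: eq_bigr => i _; rewrite (bigID (fun j : 'I_n => (i < j)%N)) /=.
congr (_ * _); apply: eq_bigl => j; rewrite -val_eqE /=; by case: ltngtP.
Qed.

(** A permutation acts on unordered pairs, and a symmetric [g] only depends on the unordered
    pair. *)
Lemma prod_lt_perm n (g : 'I_n -> 'I_n -> K) (s : 'S_n) :
  (forall i j, g i j = g j i) ->
  \prod_(i < n) \prod_(j < n | (i < j)%N) g (s i) (s j)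
  = \prod_(i < n) \prod_(j < n | (i < j)%N) g i j.
Proof.
move=> g_sym; rewrite !pair_big_dep /=.
(* The image of a pair under [u], put in increasing order; on increasing pairs, [psi] of the inverse
   permutation is inverse to [psi u]. *)
pose psi (u : 'S_n) (p : 'I_n * 'I_n) :=
  if (u p.1 < u p.2)%N then (u p.1, u p.2) else (u p.2, u p.1).
have psi_lt (u : 'S_n) (p : 'I_n * 'I_n) :
    (p.1 < p.2)%N -> ((psi u p).1 < (psi u p).2)%N.
  move=> p12; rewrite /psi; case: ifPn => //=; rewrite -leqNgt leq_eqVlt.
  by case/predU1P => // /val_inj/perm_inj E; rewrite E ltnn in p12.
have psiK (u : 'S_n) (p : 'I_n * 'I_n) :
    (p.1 < p.2)%N -> psi u (psi (u^-1)%g p) = p.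
  case: p => i j /= ij; rewrite /psi /=.
  case: ((u^-1)%g i < (u^-1)%g j)%N => /=; rewrite !permKV.
    by rewrite ij.
  by rewrite ltnNge ltnW.
rewrite (reindex_onto (psi (s^-1)%g) (psi s)) /=; last first.
  by move=> p p12; have := psiK (s^-1)%g p p12; rewrite invgK.
apply: eq_big => [p|p _].
  apply/andP/idP => [[p12 /eqP <-]|p12]; first exact: psi_lt.
  by rewrite psi_lt// psiK.
by rewrite /psi; case: ifP => _ /=; rewrite !permKV.
Qed.

End PairProducts.

(** * The sum of residues as a sum over signed permutations *)

Section SignedPermutations.
Variables (K : numFieldType) (n : nat) (t : 'I_n -> K).
Hypothesis t_neq0 : forall i, t i != 0.
Hypothesis t_neq : forall i j, i != j -> t i != t j.
Hypothesis t_neqN : forall i j, i != j -> t i != - t j.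

Definition signed_root (x : bool * 'I_n) := if x.1 then t x.2 else - t x.2.
Local Notation W := signed_root.

Let sign_weight (e : {ffun 'I_n -> bool}) i := W (e i, i).

(** This is where genericity makes the poles simple: [t_neq0] separates the two poles of one index,
    [t_neq] and [t_neqN] those of different indices. *)
Lemma signed_root_inj : injective W.
Proof.
move=> [b i] [c j]; rewrite /signed_root /=.
have [<-|ij] := eqVneq i j.
  have tN : t i != - t i.
    by rewrite -subr_eq0 opprK -mulr2n mulrn_eq0 (negbTE (t_neq0 i)).
  case: b; case: c => // /eqP; first by rewrite (negbTE tN).
  by rewrite eq_sym (negbTE tN).
have := t_neq ij; have := t_neqN ij => /negbTE N1 /negbTE N2.
case: b; case: c => /eqP; rewrite ?N1 ?N2 ?eqr_opp ?N2//.
by rewrite eqr_oppLR N1.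
Qed.

Lemma prod_signed_root z : \prod_i (z - W i)
  = (-1) ^+ n * \prod_(j < n) ((t j - z) * (t j + z)).
Proof.
rewrite -(pair_bigA _ (fun b j => z - W (b, j))) big_bool /= -big_split /=.
rewrite -[in X in (-1) ^+ X](card_ord n) -prodrN; apply: eq_bigr => j _.
by rewrite /signed_root /=; ring.
Qed.

(** The opposite pole contributes [2 * W x], and each of the [n - 1] other indices a sign times
    [(t j - W x) * (t j + W x)]. These signs, the [(-1) ^+ n] from [prod_signed_root] and the minus
    of the clockwise orientation cancel. *)
Lemma residue_coef x :
  (-1) ^+ n * - (\prod_(j | j != x) (W x - W j))^-1
  = (2 * W x * \prod_(j | j != x.2) ((t j - W x) * (t j + W x)))^-1.
Proof.
suff -> : \prod_(j | j != x) (W x - W j) =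
    - (-1) ^+ n * (2 * W x * \prod_(j | j != x.2) ((t j - W x) * (t j + W x))).
  by rewrite mulNr invrN opprK invfM mulrA mulfV ?mul1r// signr_eq0.
case: x => b i /=; rewrite (bigID (fun p : bool * 'I_n => p.2 == i)) /=.
rewrite (big_pred1 (~~ b, i)); last first.
  move=> [c j]; rewrite /= !xpair_eqE.
  by case: (j == i); case: b; case: c; rewrite ?andbF.
rewrite (eq_bigl (fun p : bool * 'I_n => p.2 != i)); last first.
  by move=> [c j]; rewrite /= xpair_eqE; case: (j == i); rewrite ?andbF.
rewrite -(pair_big predT (fun j => j != i) (fun c j => W (b, i) - W (c, j))) /=.
rewrite big_bool /= -big_split /=.
rewrite (eq_bigr (fun j => - ((t j - W (b, i)) * (t j + W (b, i)))));
  last by move=> j _; rewrite /signed_root /=; ring.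
rewrite prodrN cardC1 card_ord mulrA.
have -> : W (b, i) - W (~~ b, i) = 2 * W (b, i).
  by rewrite /signed_root /=; case: b => /=; ring.
have -> : (-1) ^+ n = - (-1) ^+ n.-1 :> K.
  by rewrite -[in LHS](ltn_predK (ltn_ord i)) exprS mulN1r.
by rewrite opprK mulrCA mulrA.
Qed.

Variable V : mpoly.mpoly n K.
Hypothesis V_sym : V \is @mpoly.symmetric n K.

Let numer (u : 'I_n -> K) := mpoly.meval u V
  * (\prod_(i < n) \prod_(j < n | j != i) (u j - u i))
  * (\prod_(i < n) \prod_(j < n | (i < j)%N) (u i + u j)).

Let coef x := (2 * W x * \prod_(j | j != x.2) ((t j - W x) * (t j + W x)))^-1.

(** All three factors are symmetric, the first by [V_sym]. *)
Lemma numer_perm u (s : 'S_n) : numer (u \o s) = numer u.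
Proof.
rewrite /numer -meval_msym (mpoly.issymP _ V_sym) /=; congr (_ * _ * _).
  rewrite [RHS](reindex_inj (@perm_inj _ s)) /=; apply: eq_bigr => i _.
  rewrite [RHS](reindex_inj (@perm_inj _ s)) /=; apply: eq_bigl => j.
  by rewrite (inj_eq perm_inj).
by apply: (prod_lt_perm (g := fun i j => u i + u j)) => i j; rewrite addrC.
Qed.

(** Equal signs kill a factor of the product of differences, opposite signs a factor of the product
    of sums. *)
Lemma numer_eq0 (s : n.-tuple (bool * 'I_n)) k l : k != l ->
  (tnth s k).2 = (tnth s l).2 -> numer (fun i => W (tnth s i)) = 0.
Proof.
wlog kl : k l / (k < l)%N => [H|] neq E.
  have [kl|lk|/val_inj kl] := ltngtP k l; first exact: H E.
    by apply: (H l k) => //; rewrite eq_sym.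
  by rewrite kl eqxx in neq.
rewrite /numer.
have [E1|E1] := eqVneq (tnth s k).1 (tnth s l).1.
  rewrite (bigD1 k)//= (bigD1 l)//=; last by rewrite eq_sym.
  have -> : tnth s k = tnth s l.
    by move: E E1; case: (tnth s k) => ? ?; case: (tnth s l) => ? ? /= -> ->.
  by rewrite subrr !mul0r mulr0 mul0r.
suff W0 : W (tnth s k) + W (tnth s l) = 0.
  have -> : \prod_(i < n) \prod_(j < n | (i < j)%N)
      (W (tnth s i) + W (tnth s j)) = 0.
    by rewrite (bigD1 k)//= (bigD1 l)//= W0 !mul0r.
  by rewrite mulr0.
move: E E1; rewrite /signed_root.
case: (tnth s k) => b ?; case: (tnth s l) => c ? /= ->.
by case: b; case: c => // _; rewrite ?subrr ?addNr.
Qed.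

(** Since [u j] is [t j] up to sign, (t_j - u_i)(t_j + u_i) = (u_j - u_i)(u_j + u_i). The
    denominators of the [coef] thus multiply to [A * (B * B)] times the product of the [2 * u i];
    the numerator cancels [A] and one [B], which leaves the product of tangent weights. *)
Lemma numer_sign_weight (e : {ffun 'I_n -> bool}) :
  let u := sign_weight e in
  numer u * \prod_k coef (e k, k)
  = mpoly.meval u V / ((\prod_(i < n) \prod_(j < n | (i < j)%N) (u i + u j))
                       * \prod_(i < n) (2 * u i)).
Proof.
move=> u; rewrite /numer.
set A := \prod_i \prod_(j | _) (_ - _).
set B := \prod_(i < n) \prod_(j < n | _) (_ + _).
have uinj i j : i != j -> u i - u j != 0 /\ u i + u j != 0.
  move=> ij; split.
    rewrite subr_eq0; apply: contra ij => /eqP/signed_root_inj [_ ->]//.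
  (* Writing [u j] as minus the opposite pole makes [u i + u j] a difference of two distinct
     poles. *)
  have -> : u j = - W (~~ e j, j).
    rewrite /u /sign_weight /signed_root /=.
    by case: (e j) => //=; rewrite opprK.
  rewrite subr_eq0; apply: contra ij => /eqP/signed_root_inj [_ ->]//.
have A0 : A != 0.
  rewrite prodf_seq_neq0; apply/allP => i _ /=.
  rewrite prodf_seq_neq0; apply/allP => j _ /=; apply/implyP => ji.
  by have [] := uinj _ _ ji.
have B0 : B != 0.
  rewrite prodf_seq_neq0; apply/allP => i _ /=.
  rewrite prodf_seq_neq0; apply/allP => j _ /=; apply/implyP => ij.
  have /uinj[_ //] : i != j by rewrite -val_eqE ltn_eqF.
have C0 : \prod_(i < n) (2 * u i) != 0.
  rewrite prodf_seq_neq0; apply/allP => i _ /=; rewrite mulf_neq0 ?pnatr_eq0//.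
  by rewrite /u /sign_weight /signed_root /=; case: ifP; rewrite ?oppr_eq0.
suff -> : \prod_k coef (e k, k) = (\prod_(i < n) (2 * u i) * (A * (B * B)))^-1.
  by field; apply/and3P.
rewrite /coef prodfV big_split /=; congr (_ * _)^-1.
rewrite -{2}/B.
have -> : B * B = \prod_i \prod_(j | j != i) (u i + u j).
  rewrite prod_neqE; congr (_ * _).
  apply: eq_bigr => i _; apply: eq_bigr => j _.
  by rewrite addrC.
rewrite /A -big_split /=; apply: eq_bigr => i _.
rewrite -big_split /=; apply: eq_bigr => j _.
rewrite -/(u i) -![_ * _]subr_sqr [u i + _]addrC -subr_sqr; congr (_ - _).
by rewrite /u /sign_weight /signed_root /=; case: (e j); rewrite ?sqrrN.
Qed.

(** Tuples with a repeated index drop out by [numer_eq0]; the others are parametrized by a sign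
    vector and a permutation, and their terms do not depend on the permutation. *)
Lemma sum_signed_tuples :
  \sum_(s : n.-tuple (bool * 'I_n))
     numer (fun i => W (tnth s i)) * \prod_k coef (tnth s k)
  = n`!%:R * \sum_(e : {ffun 'I_n -> bool})
      (mpoly.meval (sign_weight e) V
       / ((\prod_(i < n) \prod_(j < n | (i < j)%N)
             (sign_weight e i + sign_weight e j))
          * \prod_(i < n) (2 * sign_weight e i))).
Proof.
(* Signs are attached to the index of the pole and not to the variable, hence [p.1 (p.2 k)]; for a
   fixed [p.1] all permutations then give the same term. *)
pose h (p : {ffun 'I_n -> bool} * 'S_n) : n.-tuple (bool * 'I_n) :=
  [tuple (p.1 (p.2 k), p.2 k) | k < n].
have h_inj : injective h.
  move=> [e s] [e' s'] /(congr1 (fun u => tnth u)) E.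
  have {}E k : (e (s k), s k) = (e' (s' k), s' k).
    by have := congr1 (@^~ k) E; rewrite !tnth_mktuple.
  have ss : s = s' by apply/permP => k; have [] := E k.
  congr pair => //; apply/ffunP => k.
  by have := E ((s^-1)%g k); rewrite -ss permKV => -[].
have hP (s : n.-tuple (bool * 'I_n)) : s \notin (h @: predT)%SET ->
    numer (fun i => W (tnth s i)) = 0.
  move=> sh; have [inj|] := boolP (injectiveb (fun k => (tnth s k).2)).
    (* The sign of an index is read off at the one position where that index occurs. *)
    have si := injectiveP _ inj; case/negP: sh; apply/imsetP; exists
     ([ffun i => (tnth s ((perm si)^-1%g i)).1], perm si) => //.
    apply: eq_from_tnth => k; rewrite tnth_mktuple /= ffunE permK permE.
    exact: surjective_pairing.
  by case/injectivePn => k [l kl E]; exact: numer_eq0 kl E.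
rewrite (bigID (mem (h @: predT)%SET)) /= [X in _ + X]big1 ?addr0; last first.
  by move=> s /hP ->; rewrite mul0r.
rewrite big_imset /=; last by move=> ? ? _ _; exact: h_inj.
transitivity (\sum_(p : {ffun 'I_n -> bool} * 'S_n)
   numer (sign_weight p.1) * \prod_k coef (p.1 k, k)).
  apply: eq_bigr => -[e s] _ /=.
  rewrite -(numer_perm (sign_weight e) s); congr (_ * _).
    by congr numer; apply/funext => k; rewrite tnth_mktuple.
  rewrite [RHS](reindex_inj (@perm_inj _ s)) /=; apply: eq_bigr => k _.
  by rewrite tnth_mktuple.
rewrite -(pair_bigA _ (fun e (s : 'S_n) =>
   numer (sign_weight e) * \prod_k coef (e k, k))) /=.
rewrite mulr_sumr; apply: eq_bigr => e _.
by rewrite sumr_const card_Sn numer_sign_weight mulr_natl.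
Qed.

End SignedPermutations.

(** * Classification of the torus-fixed Lagrangian subspaces *)

Section FixedPoints.
Variables (R : realType) (n : nat).
Implicit Types (e : {ffun 'I_n -> bool}) (L : {vspace symplectic_space R n}).

(* p_I is the row space of this matrix for e the indicator function of I. *)
Let fixed_mx e : 'M[R[i]]_(n, n + n) :=
  row_mx (diag_mx (\row_i (e i)%:R)) (diag_mx (\row_i (~~ e i)%:R)).

Definition fixed_point e : {vspace symplectic_space R n} :=
  limg (linfun (mulmxr (fixed_mx e) : 'rV[R[i]]_n -> 'rV[R[i]]_(n + n))).

Let mulmx_fixed_mx e (u : 'rV[R[i]]_n) i :
  (u *m fixed_mx e) 0 (lshift n i) = u 0 i * (e i)%:R /\
  (u *m fixed_mx e) 0 (rshift n i) = u 0 i * (~~ e i)%:R.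
Proof. by rewrite mul_mx_row row_mxEl row_mxEr !mul_mx_diag !mxE. Qed.

Lemma symplectic_eqP (u v : symplectic_space R n) :
  (forall i, u 0 (lshift n i) = v 0 (lshift n i)) ->
  (forall i, u 0 (rshift n i) = v 0 (rshift n i)) -> u = v.
Proof. by move=> l r; apply/rowP => k; case: (split_ordP k) => j ->. Qed.

Lemma mem_fixed_point e (v : symplectic_space R n) :
  (v \in fixed_point e) <->
  forall i, (if e i then v 0 (rshift n i) else v 0 (lshift n i)) = 0.
Proof.
split=> [/memv_imgP[u _ ->] i|H].
  rewrite lfunE /=; have [-> ->] := mulmx_fixed_mx e u i.
  by case: (e i); rewrite mulr0.
(* For each [i] one of the two summands vanishes, so the sum is the surviving coordinate whichever
   it is. *)
pose u : 'rV[R[i]]_n := \row_i (v 0 (lshift n i) + v 0 (rshift n i)).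
have -> : v = linfun (mulmxr (fixed_mx e) : 'rV_n -> 'rV_(n + n)) u.
  apply: symplectic_eqP => i; rewrite lfunE /=;
    have [E1 E2] := mulmx_fixed_mx e u i; have := H i; rewrite ?E1 ?E2 mxE.
    by case: (e i) => ->; rewrite ?mulr0 ?mulr1 ?addr0.
  by case: (e i) => ->; rewrite ?mulr0 ?mulr1 ?add0r.
exact/memv_img/memvf.
Qed.

Lemma dim_fixed_point e : \dim (fixed_point e) = n.
Proof.
rewrite /fixed_point limg_dim_eq ?dimvf ?dim_matrix; first exact: mul1n.
apply/eqP; rewrite -subv0; apply/subvP => u.
rewrite memv_cap memvf memv_ker lfunE /= memv0 => /eqP u0.
apply/eqP/rowP => i; have [E1 E2] := mulmx_fixed_mx e u i.
by move: E1 E2; rewrite u0 !mxE; case: (e i); rewrite mulr1.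
Qed.

Let q_vecE i j :
  (q_vec R i 0 (lshift n j) = (j == i)%:R) * (q_vec R i 0 (rshift n j) = 0).
Proof. by rewrite /q_vec !mxE eqxx eq_lshift eq_rlshift. Qed.

Let p_vecE i j :
  (p_vec R i 0 (lshift n j) = 0) * (p_vec R i 0 (rshift n j) = (j == i)%:R).
Proof. by rewrite /p_vec !mxE eqxx eq_lrshift eq_rshift. Qed.

(** Recovers [e] from the subspace; this yields both injectivity of [fixed_point] and the values of
    [fixed_weight]. *)
Lemma q_vec_fixed_point e i : (q_vec R i \in fixed_point e) = e i.
Proof.
apply/idP/idP => [/mem_fixed_point/(_ i)|ei].
  by rewrite !q_vecE eqxx; case: (e i) => // /eqP; rewrite oner_eq0.
apply/mem_fixed_point => j; rewrite !q_vecE.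
by case: eqVneq => [->|_]; [rewrite ei|case: ifP].
Qed.

Lemma fixed_point_inj : injective fixed_point.
Proof. by move=> e e' E; apply/ffunP => i; rewrite -!q_vec_fixed_point E. Qed.

Let torus_actE (x : 'I_n -> R[i]) (v : symplectic_space R n) i :
  (torus_act x v 0 (lshift n i) = v 0 (lshift n i) * x i) *
  (torus_act x v 0 (rshift n i) = v 0 (rshift n i) * (x i)^-1).
Proof.
rewrite /torus_act lfunE /= mul_mx_diag; split.
  by rewrite mxE row_mxEl mxE.
by rewrite mxE row_mxEr mxE.
Qed.

Lemma fixed_point_LG e : LG (fixed_point e).
Proof.
split; first exact: dim_fixed_point.
move=> u v /mem_fixed_point Hu /mem_fixed_point Hv; apply: big1 => i _.
have := Hu i; have := Hv i.
by case: (e i) => -> ->; rewrite ?mulr0 ?mul0r subrr.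
Qed.

Lemma fixed_point_torus_fixed e : torus_fixed (fixed_point e).
Proof.
have sub (x : 'I_n -> R[i]) v :
    v \in fixed_point e -> torus_act x v \in fixed_point e.
  move=> /mem_fixed_point Hv; apply/mem_fixed_point => i.
  by rewrite !torus_actE; have := Hv i; case: (e i) => ->; rewrite mul0r.
move=> x x0; apply/eqP; rewrite eqEsubv; apply/andP; split; apply/subvP => v.
  by move=> /memv_imgP[u uL ->]; exact: sub.
move=> vL; have -> : v = torus_act x (torus_act (fun i => (x i)^-1) v).
  by apply: symplectic_eqP => i; rewrite !torus_actE ?invrK ?mulfK ?mulfVK// x0.
exact/memv_img/sub.
Qed.

(* If only the i-th coordinate c of the torus element differs from 1, then
   acting on v and subtracting v isolates the (q_i, p_i)-component of v, with
   coefficients c - 1 and c^-1 - 1; c = -1 and c = 2 give independent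
   combinations. *)
Lemma torus_fixed_components L (v : symplectic_space R n) i :
  torus_fixed L -> v \in L ->
  v 0 (lshift n i) *: q_vec R i \in L /\ v 0 (rshift n i) *: p_vec R i \in L.
Proof.
move=> fixL vL; set a := v 0 (lshift n i); set b := v 0 (rshift n i).
have comb (c : R[i]) : c != 0 ->
    (c - 1) *: (a *: q_vec R i) + (c^-1 - 1) *: (b *: p_vec R i) \in L.
  move=> c0; pose x j := if j == i then c else 1.
  have x0 j : x j != 0 by rewrite /x; case: ifP; rewrite ?oner_eq0.
  have TL : torus_act x v - v \in L.
    apply: rpredB => //.
    by have := memv_img (torus_act x) vL; rewrite (fixL x x0).
  suff -> : (c - 1) *: (a *: q_vec R i) + (c^-1 - 1) *: (b *: p_vec R i)
            = torus_act x v - v by [].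
  have entry (y z d d' : R[i]) (u u' : symplectic_space R n) k :
      (d *: (y *: u) + d' *: (z *: u')) 0 k
      = d * (y * u 0 k) + d' * (z * u' 0 k).
    by rewrite !mxE.
  have entryB (u w : symplectic_space R n) k : (u - w) 0 k = u 0 k - w 0 k.
    by rewrite !mxE.
  apply: symplectic_eqP => j; rewrite entry entryB torus_actE q_vecE p_vecE /x.
    by case: eqVneq => [->|_]; rewrite -/a /=; ring.
  by case: eqVneq => [->|_]; rewrite -/b ?invr1 /=; ring.
have two0 : 2 != 0 :> R[i] by rewrite pnatr_eq0.
have three0 : 3 != 0 :> R[i] by rewrite pnatr_eq0.
have C1 : a *: q_vec R i + b *: p_vec R i \in L.
  have /comb : (-1 : R[i]) != 0 by rewrite oppr_eq0 oner_eq0.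
  rewrite invrN1 -scalerDr => /(memvZ (-1 - 1)^-1).
  by rewrite scalerA mulVf ?scale1r// -opprD oppr_eq0.
have C2 := comb 2 two0.
(* For c = 2 the combination is a q_i - (1/2) b p_i; subtracted from a q_i + b p_i it leaves (3/2) b
   p_i. *)
have C3 : b *: p_vec R i \in L.
  have := rpredB C1 C2; rewrite (_ : 2 - 1 = 1 :> R[i]); last by ring.
  rewrite scale1r opprD addrACA subrr add0r -[X in X - _]scale1r -scalerBl.
  rewrite (_ : 1 - (2^-1 - 1) = 3 / 2 :> R[i]); last by field.
  move=> /(memvZ (3 / 2)^-1).
  by rewrite scalerA mulVf ?scale1r// mulf_neq0 ?invr_eq0.
by split=> //; have := rpredB C1 C3; rewrite addrK.
Qed.

(** The form takes the value 1 on (q_i, p_i), so an isotropic [L] cannot contain both. With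
    [torus_fixed_components], every vector of [L] then has no p_i-component if q_i is in [L] and no
    q_i-component otherwise; equality follows from the dimensions. *)
Lemma torus_fixed_LG L : LG L -> torus_fixed L ->
  L = fixed_point [ffun i => q_vec R i \in L].
Proof.
move=> [dimL isoL] fixL; apply/eqP.
rewrite eqEdim dim_fixed_point dimL leqnn andbT.
have scale_in (c : R[i]) (w : symplectic_space R n) :
    c != 0 -> c *: w \in L -> w \in L.
  by move=> c0 /(memvZ c^-1); rewrite scalerA mulVf// scale1r.
apply/subvP => v vL; apply/mem_fixed_point => i; rewrite ffunE.
have [qv pv] := torus_fixed_components i fixL vL.
case: ifPn => [qL|/negP qL]; apply/eqP/contraT => v0; last first.
  by case: qL; exact: scale_in qv.
have pL := scale_in _ _ v0 pv.
have := isoL _ _ qL pL; rewrite /symplectic_form (bigD1 i)//= big1 => [|j ji].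
  rewrite !q_vecE !p_vecE eqxx mulr1 mul0r subr0 addr0 => /eqP.
  by rewrite oner_eq0.
by rewrite !q_vecE !p_vecE (negbTE ji) !mul0r subrr.
Qed.

Lemma LG_integralE (t : 'I_n -> R[i])
    (alpha : {vspace symplectic_space R n} -> R[i]) :
  LG_integral t alpha
  = \sum_(e : {ffun 'I_n -> bool})
      alpha (fixed_point e) / tangent_euler t (fixed_point e).
Proof.
rewrite /LG_integral.
have -> : @LG R n `&` @torus_fixed R n =
    [set fixed_point e | e in [set` enum {: {ffun 'I_n -> bool}}]].
  apply/seteqP; split=> [L [LGL fixL]|_ [e _ <-]].
    exists [ffun i => q_vec R i \in L]; first by rewrite /= mem_enum.
    by rewrite -torus_fixed_LG.
  by split; [exact: fixed_point_LG|exact: fixed_point_torus_fixed].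
rewrite fsbig_image; last by move=> ? ? _ _; exact: fixed_point_inj.
by rewrite -fsbig_seq ?enum_uniq// big_enum.
Qed.

End FixedPoints.

(** * Comparison of the iterated residue with the localization sum *)

Theorem mainTheorem4 (R : realType) (n : nat) (t : 'I_n -> R[i])
    (t_neq0 : forall i, t i != 0)
    (t_neq : forall i j, i != j -> t i != t j)
    (t_neqN : forall i j, i != j -> t i != - t j)
    (V : mpoly.mpoly n R[i]) (V_sym : V \is @mpoly.symmetric n R[i]) :
  is_residue_at_infinity
    (fun z : n.-tuple R[i] =>
       (n`!%:R)^-1 *
       (mpoly.meval (tnth z) V
        * (\prod_(i < n) \prod_(j < n | j != i) (tnth z j - tnth z i))
        * (\prod_(i < n) \prod_(j < n | (i < j)%N) (tnth z i + tnth z j))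
        / \prod_(i < n) \prod_(j < n) ((t i - tnth z j) * (t i + tnth z j))))
    (LG_integral t (char_class V t)).
Proof.
pose W := signed_root t.
(* A real bound for the norms of all poles, so that radii above [M] enclose them; [complex.Re]
   converts the norm, an element of [R[i]], to [R]. *)
pose M := \sum_x complex.Re `|W x|.
have Wge0 x : 0 <= complex.Re `|W x|.
  by have /andP[_] : 0 <= `|W x| := normr_ge0 _.
have nW x : `|W x| = (complex.Re `|W x|)%:C by rewrite normc_def.
have WM x : `|W x| <= M%:C.
  rewrite nW lecR /M (bigD1 x)// lerDl; exact: sumr_ge0.
have M0 : 0 <= M by exact: sumr_ge0.
apply: (near_separated_radii_gt (M := M)) => r rM.
pose numer (z : n.-tuple R[i]) := mpoly.meval (tnth z) V
  * (\prod_(i < n) \prod_(j < n | j != i) (tnth z j - tnth z i))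
  * (\prod_(i < n) \prod_(j < n | (i < j)%N) (tnth z i + tnth z j)).
(* Each of the [n] variables contributes one [(-1) ^+ n] when its denominator is rewritten as a
   product of the [z - W x]. *)
pose d : R[i] := (n`!%:R)^-1 * ((-1) ^+ n) ^+ n.
transitivity (torus_integral r
    (fun z => d * numer z / \prod_(k < n) \prod_x (tnth z k - W x))).
  congr torus_integral; apply/funext => z.
  have -> : \prod_(k < n) \prod_x (tnth z k - W x) = ((-1) ^+ n) ^+ n *
      \prod_(i < n) \prod_(j < n) ((t i - tnth z j) * (t i + tnth z j)).
    under eq_bigr do rewrite prod_signed_root.
    by rewrite big_split /= prodr_const card_ord [in RHS]exchange_big.
  rewrite -/(numer z) invfM /d; move: (numer z) => a.
  rewrite -!mulrA; congr (_ * _).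
  by rewrite [RHS]mulrCA mulVKf// expf_neq0// signr_eq0.
rewrite torus_integral_rational; first last.
- by move=> k x; apply: le_lt_trans (WM x) _; rewrite ltcR.
- by move=> k; exact: le_lt_trans M0 (rM k).
- apply: separately_polynomialM; first exact: separately_polynomial_cst.
  apply: separately_polynomialM; [apply: separately_polynomialM|].
  + exact: separately_polynomial_meval.
  + apply: separately_polynomial_prod => i.
    apply: separately_polynomial_prod => j.
    apply: separately_polynomialD; first exact: separately_polynomial_tnth.
    under eq_fun do rewrite -mulN1r.
    apply: separately_polynomialM; first exact: separately_polynomial_cst.
    exact: separately_polynomial_tnth.
  + apply: separately_polynomial_prod => i.
    apply: separately_polynomial_prod => j.
    by apply: separately_polynomialD; exact: separately_polynomial_tnth.
- exact: signed_root_inj.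
have nfact : n`!%:R != 0 :> R[i] by rewrite pnatr_eq0 -lt0n fact_gt0.
rewrite LG_integralE; apply: (mulfI nfact).
have := sum_signed_tuples t_neq0 t_neq t_neqN V_sym.
have -> : \sum_(e : {ffun 'I_n -> bool}) char_class V t (fixed_point R e)
      / tangent_euler t (fixed_point R e) = \sum_(e : {ffun 'I_n -> bool})
    (mpoly.meval (fun i => signed_root t (e i, i)) V /
      ((\prod_(i < n) \prod_(j < n | (i < j)%N)
          (signed_root t (e i, i) + signed_root t (e j, j)))
       * \prod_(i < n) (2 * signed_root t (e i, i)))).
  apply: eq_bigr => e _; rewrite /char_class /tangent_euler.
  have fw : fixed_weight t (fixed_point R e) = fun i => signed_root t (e i, i).
    by apply/funext => i; rewrite /fixed_weight q_vec_fixed_point.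
  by rewrite fw.
move=> <-; rewrite mulr_sumr; apply: eq_bigr => s _.
have -> : numer (map_tuple W s) =
    mpoly.meval (fun i => W (tnth s i)) V
    * (\prod_(i < n) \prod_(j < n | j != i) (W (tnth s j) - W (tnth s i)))
    * (\prod_(i < n) \prod_(j < n | (i < j)%N) (W (tnth s i) + W (tnth s j))).
  rewrite /numer (_ : tnth (map_tuple W s) = fun i => W (tnth s i))//.
  by apply/funext => i; rewrite tnth_map.
(* This makes the [n] factors [(-1) ^+ n] reappear, one per variable, to be matched with those in
   [d]. *)
under [in RHS]eq_bigr do rewrite -residue_coef.
rewrite big_split /= prodr_const card_ord /d -/W.
by field.
Qed.
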